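(* Let $n\ge 1$, let $I_k\ge 0$ and $D_k>0$ be real numbers for $k=1,\ldots,n$, let $R\in\mathbb{Z}_{\ge 0}$, and let $\underline{\ell},\overline{\ell}$ be real numbers with $0<\underline{\ell}\le 1\le\overline{\ell}$. Put $\tau_{\mathrm{all}}=\frac{R+\sum_{k=1}^n I_k}{\sum_{k=1}^n D_k}$ and $T_k=\tau_{\mathrm{all}}D_k$. Assume $\lambda_1,\lambda_2>0$ and $M\ge\max_{k=1,\ldots,n}\{\underline{\ell}\,T_k-I_k,\ I_k+R-\overline{\ell}\,T_k,\ 0\}$. Consider the knapsack-inspired problem $$\text{(KI)}\qquad \max_{\boldsymbol{x},\boldsymbol{y},\boldsymbol{z}}\ \lambda_1\sum_{k=1}^n y_k-\lambda_2\sum_{k=1}^n|I_k+x_k-T_k|$$ subject to $\sum_{k=1}^n x_k=R$ and, for all $k=1,\ldots,n$, $$I_k+x_k\ge\underline{\ell}\,T_k-M(1-z_k),\quad I_k+x_k\le\overline{\ell}\,T_k+M(1-z_k),$$ $$y_k\le x_k,\quad y_k\le R\,z_k,\quad y_k\ge x_k-R(1-z_k),\quad y_k\ge 0,\quad x_k\in\mathbb{Z}_{\ge 0},\quad z_k\in\{0,1\};$$ and the linearized knapsack-inspired problem $$\text{(LKI)}\qquad \max_{\boldsymbol{x},\boldsymbol{y},\boldsymbol{z},\boldsymbol{\delta}}\ \lambda_1\sum_{k=1}^n y_k-\lambda_2\sum_{k=1}^n\delta_k$$ subject to all the constraints of (KI) on $(\boldsymbol{x},\boldsymbol{y},\boldsymbol{z})$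 and, in addition, for all $k=1,\ldots,n$, $$\delta_k\ge I_k+x_k-T_k,\quad \delta_k\ge T_k-I_k-x_k,\quad \delta_k\ge 0,$$ where $\boldsymbol{x},\boldsymbol{y},\boldsymbol{z},\boldsymbol{\delta}$ are the vectors with components $x_k,y_k,z_k,\delta_k$, and $y_k,\delta_k$ are real. Then (KI) and (LKI) are equivalent: they have the same optimal objective value, and $(\boldsymbol{x},\boldsymbol{y},\boldsymbol{z})$ is an optimal solution of (KI) if and only if there exists $\boldsymbol{\delta}$ such that $(\boldsymbol{x},\boldsymbol{y},\boldsymbol{z},\boldsymbol{\delta})$ is an optimal solution of (LKI).
   Context: Setting: a total integer replenishment quantity $R$ is to be allocated over $n$ warehouses; $I_k$ is the on-hand inventory and $D_k$ the forecast daily demand at warehouse $k$, and $x_k$ is the quantity allocated to warehouse $k$. The system-level target inventory days are $\tau_{\mathrm{all}}=\sum_k(I_k+x_k)/\sum_k D_k$, which by the conservation constraint $\sum_k x_k=R$ is the instance constant $(R+\sum_k I_k)/\sum_k D_k$; the target inventory level of warehouse $k$ is $T_k=\tau_{\mathrm{all}}D_k$. The parameters $\underline{\ell},\overline{\ell}$ define a relative band around the target, $z_k$ is a binary band-compliance indicator, and $M$ is a Big-$M$ constant. *)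

(* Defs.v *)
From HB Require Import structures.
From mathcomp Require Import all_boot all_order all_algebra.
From mathcomp Require Import reals.

Set Implicit Arguments.
Unset Strict Implicit.
Unset Printing Implicit Defensive.

Import Order.TTheory GRing.Theory Num.Theory.
Local Open Scope ring_scope.

Section Maximization.
Variables (R : realType) (S : Type) (feasible : S -> Prop) (objective : S -> R).

Definition optimal_solution (s : S) : Prop :=
  feasible s /\ forall t, feasible t -> objective t <= objective s.

(* The optimal value is an attained maximum, not just a supremum. *)
Definition optimal_value (v : R) : Prop :=
  exists2 s, optimal_solution s & objective s = v.

End Maximization.

Record instance (R : realType) (n : nat) := Instance {
  onhand : 'I_n -> R;       (* I_k *)
  demand : 'I_n -> R;       (* D_k *)
  total : nat;              (* the replenishment quantity R *)
  lo : R;                   (* lower band factor, \underline{\ell} *)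
  hi : R;                   (* upper band factor, \overline{\ell} *)
  lambda1 : R;
  lambda2 : R;
  bigM : R }.

Section Problems.
Variables (R : realType) (n : nat) (P : instance R n).

Definition tau_all : R :=
  ((total P)%:R + \sum_(k < n) onhand P k) / \sum_(k < n) demand P k.

Definition target (k : 'I_n) : R := tau_all * demand P k.

(* max_k { lo T_k - I_k, I_k + R - hi T_k, 0 }; the default value 0 of the
   iterated maximum is itself one of the listed terms. *)
Definition bigM_threshold : R :=
  \big[Num.max/0]_(k < n)
    Num.max (lo P * target k - onhand P k)
      (Num.max (onhand P k + (total P)%:R - hi P * target k) 0).

(* (x, y, z): integrality of x and binarity of z are carried by the types. *)
Definition ki_point : Type :=
  (('I_n -> nat) * ('I_n -> R) * ('I_n -> bool))%type.

(* (x, y, z, delta) *)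
Definition lki_point : Type := (ki_point * ('I_n -> R))%type.

Definition ki_feasible (s : ki_point) : Prop :=
  let: (x, y, z) := s in
  (\sum_(k < n) x k)%N = total P /\
  forall k : 'I_n,
    [/\ onhand P k + (x k)%:R >= lo P * target k - bigM P * (1 - (z k)%:R),
        onhand P k + (x k)%:R <= hi P * target k + bigM P * (1 - (z k)%:R)
      & [/\ y k <= (x k)%:R,
            y k <= (total P)%:R * (z k)%:R,
            y k >= (x k)%:R - (total P)%:R * (1 - (z k)%:R)
          & y k >= 0]].

Definition ki_objective (s : ki_point) : R :=
  let: (x, y, z) := s in
  lambda1 P * (\sum_(k < n) y k)
  - lambda2 P * (\sum_(k < n) `|onhand P k + (x k)%:R - target k|).

Definition lki_feasible (s : lki_point) : Prop :=
  let: (x, y, z, delta) := s in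
  ki_feasible (x, y, z) /\
  forall k : 'I_n,
    [/\ delta k >= onhand P k + (x k)%:R - target k,
        delta k >= target k - onhand P k - (x k)%:R
      & delta k >= 0].

Definition lki_objective (s : lki_point) : R :=
  let: (x, y, z, delta) := s in
  lambda1 P * (\sum_(k < n) y k) - lambda2 P * (\sum_(k < n) delta k).

End Problems.

(* Main.v *)
From HB Require Import structures.
From mathcomp Require Import all_boot all_order all_algebra.
From mathcomp Require Import boolp reals.
Require Import Defs.

(** (LKI) is the epigraph form of (KI).  The three constraints on [delta k]
    say exactly that [delta k] is at least the absolute deviation from the
    target; since [lambda2] is positive, enlarging [delta] can only lower the
    objective.  Hence forgetting [delta] sends feasible points of (LKI) to
    feasible points of (KI) that are at least as good, and choosing [delta]
    equal to the deviation lifts a feasible point of (KI) with the same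
    objective.  These two facts alone identify the optimal solutions and the
    optimal values ([lift_optimal_solution], [lift_optimal_value]).

    For the common optimal value to exist, (KI) must have an optimal solution.
    The constraints on [y] are the exact linearization of [y k = x k * z k],
    and [x k] is at most the total quantity, so (KI) has only finitely many
    feasible points ([ki_feasible_decode]).  It has at least one because the
    Big-M constant is large enough to make both band constraints void when
    every indicator is switched off ([ki_feasible_exists]). *)

Set Implicit Arguments.
Unset Strict Implicit.
Unset Printing Implicit Defensive.

Import Order.TTheory GRing.Theory Num.Theory.
Local Open Scope ring_scope.

Section Optimization.
Variables (R : realType) (S : Type) (F : S -> Prop) (f : S -> R).

Lemma finite_optimal_solution (T : finType) (decode : T -> S) :
  (exists s, F s) -> (forall s, F s -> exists t, s = decode t) ->
  exists s, optimal_solution F f s.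
Proof.
move=> [s0 Fs0] dec; have [t0 s0E] := dec _ Fs0.
have Ft0 : `[< F (decode t0) >] by apply/asboolP; rewrite -s0E.
case: (@Order.TotalTheory.arg_maxP _ _ _ t0 (fun t => `[< F (decode t) >])
         (fun t => f (decode t)) Ft0) => t /asboolP Ft t_max.
exists (decode t); split=> // s Fs; have [u sE] := dec _ Fs.
by rewrite sE; apply/t_max/asboolP; rewrite -sE.
Qed.

Variables (S' : Type) (F' : S' -> Prop) (f' : S' -> R) (proj : S' -> S).
Hypothesis proj_feasible : forall t, F' t -> F (proj t).
Hypothesis proj_improves : forall t, F' t -> f' t <= f (proj t).
Hypothesis lift_feasible :
  forall s, F s -> exists t, [/\ proj t = s, F' t & f' t = f s].

(** An optimal [t] cannot be beaten by the lift of its own projection, which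
    is what forces equality of the objectives. *)
Lemma optimal_solution_proj t : optimal_solution F' f' t ->
  optimal_solution F f (proj t) /\ f (proj t) = f' t.
Proof.
move=> [Ft t_max]; have Fp := proj_feasible Ft.
have lift_le s : F s -> f s <= f' t.
  by move=> /lift_feasible[u [_ Fu <-]]; exact: t_max.
split; last by apply/le_anti; rewrite lift_le ?proj_improves.
by split=> // s /lift_le /le_trans; apply; exact: proj_improves.
Qed.

Lemma optimal_solution_lift s : optimal_solution F f s ->
  exists t, [/\ proj t = s, optimal_solution F' f' t & f' t = f s].
Proof.
move=> [Fs s_max]; have [t [tE Ft ftE]] := lift_feasible Fs.
exists t; split=> //; split=> // u Fu; rewrite ftE.
exact: le_trans (proj_improves Fu) (s_max _ (proj_feasible Fu)).
Qed.

Lemma lift_optimal_solution s : optimal_solution F f s <->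
  exists2 t, proj t = s & optimal_solution F' f' t.
Proof.
split=> [/optimal_solution_lift[t [tE t_opt _]]|[t <- /optimal_solution_proj[]//]].
by exists t.
Qed.

Lemma lift_optimal_value v : optimal_value F f v <-> optimal_value F' f' v.
Proof.
split=> [[s /optimal_solution_lift[t [_ t_opt ftE]] <-]|].
  by exists t.
move=> [t /optimal_solution_proj[p_opt fpE] <-].
by exists (proj t).
Qed.

End Optimization.

Section Knapsack.
Variables (R : realType) (n : nat) (P : instance R n).

Definition deviation (x : 'I_n -> nat) (k : 'I_n) : R :=
  `|onhand P k + (x k)%:R - target P k|.

Lemma lki_feasible_fst t : lki_feasible P t -> ki_feasible P t.1.
Proof. by case: t => -[[x y] z] delta []. Qed.

Lemma lki_objective_le t : 0 <= lambda2 P -> lki_feasible P t ->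
  lki_objective P t <= ki_objective P t.1.
Proof.
case: t => -[[x y] z] delta l2 [_ dP] /=.
rewrite lerB // ler_wpM2l // ler_sum // => k _.
by have [d1 d2 _] := dP k; rewrite ler_norml d1 andbT lerNl opprB opprD addrA.
Qed.

Lemma lki_lift s : ki_feasible P s ->
  exists t, [/\ t.1 = s, lki_feasible P t & lki_objective P t = ki_objective P s].
Proof.
case: s => -[x y] z Fs; exists (x, y, z, deviation x); split=> //; split=> // k.
split; [exact: ler_norm | | exact: normr_ge0].
by rewrite -addrA -opprD /deviation distrC ler_norm.
Qed.

Lemma ki_feasible_le_total x y z k :
  ki_feasible P (x, y, z) -> (x k <= total P)%N.
Proof. by move=> [<- _]; rewrite (bigD1 k) //= leq_addr. Qed.

(** If [z k] holds, [y k] is squeezed between two copies of [x k]; otherwise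
    between two zeros. *)
Lemma ki_feasible_y x y z k :
  ki_feasible P (x, y, z) -> y k = (x k)%:R * (z k)%:R.
Proof.
move=> [_ /(_ k)[_ _ [y_le_x y_le_z y_ge_x y_ge0]]].
case: (z k) y_le_z y_ge_x => /=.
  by rewrite subrr mulr0 subr0 !mulr1 => _ x_le_y; apply/eqP; rewrite eq_le y_le_x x_le_y.
by rewrite !mulr0 => y_le0 _; apply/eqP; rewrite eq_le y_le0 y_ge0.
Qed.

Definition ki_decode
    (c : {ffun 'I_n -> 'I_(total P).+1} * {ffun 'I_n -> bool}) : ki_point R n :=
  (fun k => c.1 k : nat, fun k => (c.1 k)%:R * (c.2 k)%:R, fun k => c.2 k).

Lemma ki_feasible_decode s : ki_feasible P s -> exists c, s = ki_decode c.
Proof.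
case: s => -[x y] z Fs; exists ([ffun k => inord (x k)], [ffun k => z k]).
have xE k : @inord (total P) (x k) = x k :> nat.
  by rewrite inordK // ltnS (ki_feasible_le_total k Fs).
congr (_, _, _); apply/funext => k; rewrite ?ffunE //= ?xE //.
exact: ki_feasible_y Fs.
Qed.

Lemma bigM_thresholdP k : bigM_threshold P <= bigM P ->
  [/\ lo P * target P k - onhand P k <= bigM P
    & onhand P k + (total P)%:R - hi P * target P k <= bigM P].
Proof.
move=> /(le_trans (le_bigmax _ _ k)).
by rewrite !ge_max => /and3P[].
Qed.

Lemma ki_feasible_exists : (0 < n)%N -> bigM_threshold P <= bigM P ->
  exists s, ki_feasible P s.
Proof.
move=> n_gt0 M_ge; pose k0 := Ordinal n_gt0.
(* The whole quantity goes to a single warehouse, with no band enforced. *)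
pose x k := if k == k0 then total P else 0%N.
have x_le k : (x k)%:R <= (total P)%:R :> R by rewrite ler_nat /x; case: ifP.
exists (x, fun=> 0, fun=> false); split.
  by rewrite -big_mkcond big_pred1_eq.
move=> k; have [lo_le hi_le] := bigM_thresholdP k M_ge.
rewrite /= subr0 !mulr1 mulr0; split.
- rewrite lerBlDr -lerBlDl in lo_le.
  by rewrite ler_wpDr ?ler0n // lerBlDr addrC -lerBlDl.
- by rewrite -lerBlDl; apply: le_trans hi_le; rewrite lerB ?lerD.
- by split; rewrite ?ler0n // subr_le0.
Qed.

End Knapsack.

Theorem theorem2 (R : realType) (n : nat) (P : instance R n)
    (n_ge1 : (1 <= n)%N)
    (onhand_ge0 : forall k, 0 <= onhand P k)
    (demand_gt0 : forall k, 0 < demand P k)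
    (lo_gt0 : 0 < lo P) (lo_le1 : lo P <= 1) (hi_ge1 : 1 <= hi P)
    (lambda1_gt0 : 0 < lambda1 P) (lambda2_gt0 : 0 < lambda2 P)
    (bigM_ge : bigM_threshold P <= bigM P) :
  (exists v : R, optimal_value (ki_feasible P) (ki_objective P) v /\
                 optimal_value (lki_feasible P) (lki_objective P) v) /\
  (forall (x : 'I_n -> nat) (y : 'I_n -> R) (z : 'I_n -> bool),
     optimal_solution (ki_feasible P) (ki_objective P) (x, y, z) <->
     exists delta : 'I_n -> R,
       optimal_solution (lki_feasible P) (lki_objective P)
         (x, y, z, delta)).
Proof.
have l2 := ltW lambda2_gt0.
have proj_le t := lki_objective_le (t := t) l2.
split=> [|x y z].
  have [s s_opt] := finite_optimal_solution (ki_objective P)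
    (ki_feasible_exists n_ge1 bigM_ge) (@ki_feasible_decode _ _ P).
  exists (ki_objective P s).
  have s_val : optimal_value (ki_feasible P) (ki_objective P)
    (ki_objective P s) by exists s.
  split=> //.
  by apply/(lift_optimal_value (@lki_feasible_fst _ _ P) proj_le (@lki_lift _ _ P)).
rewrite (lift_optimal_solution (@lki_feasible_fst _ _ P) proj_le (@lki_lift _ _ P)).
split=> [[[s delta] /= ->]|[delta]]; first by exists delta.
by exists (x, y, z, delta).
Qed.
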